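(* Let $M(f_1,\ldots,f_6)$ be a generalized $(\kappa,\mu)$-space form. For all vector fields $X,Y,Z,W$ orthogonal to $\xi$, $$R_i(\phi X,\phi Y,\phi Z,\phi W)=R_i(X,Y,Z,W)\quad\text{for } i=1,2,3,6,$$ and therefore $$R(\phi X,\phi Y,\phi Z,\phi W)-f_4R_4(\phi X,\phi Y,\phi Z,\phi W)-f_5R_5(\phi X,\phi Y,\phi Z,\phi W)$$ $$=R(X,Y,Z,W)-f_4R_4(X,Y,Z,W)-f_5R_5(X,Y,Z,W).$$ If $M$ is also a contact metric manifold, then (for $X,Y,Z,W$ orthogonal to $\xi$) $$R_4(\phi X,\phi Y,\phi Z,\phi W)=-R_4(X,Y,Z,W),\qquad R_5(\phi X,\phi Y,\phi Z,\phi W)=R_5(X,Y,Z,W),$$ and therefore $$R(\phi X,\phi Y,\phi Z,\phi W)=R(X,Y,Z,W)-2f_4R_4(X,Y,Z,W).$$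
   Context: All functions and tensors are smooth. An almost contact metric manifold $(M,\phi,\xi,\eta,g)$ is an odd-dimensional Riemannian manifold $(M,g)$ with a $(1,1)$-tensor field $\phi$, a vector field $\xi$ and a 1-form $\eta$ with $\eta(\xi)=1$, $\phi^2X=-X+\eta(X)\xi$, $g(\phi X,\phi Y)=g(X,Y)-\eta(X)\eta(Y)$. It is a contact metric manifold if $d\eta(X,Y)=g(X,\phi Y)$, with the convention $2\,d\eta(X,Y)=X\eta(Y)-Y\eta(X)-\eta([X,Y])$. Put $h=\tfrac12 L_\xi\phi$ ($L$ the Lie derivative). The curvature is $R(X,Y)Z=\nabla_X\nabla_YZ-\nabla_Y\nabla_XZ-\nabla_{[X,Y]}Z$; write $R(X,Y,Z,W)=g(R(X,Y)Z,W)$ and $R_i(X,Y,Z,W)=g(R_i(X,Y)Z,W)$. An almost contact metric manifold is a generalized $(\kappa,\mu)$-space form, denoted $M(f_1,\ldots,f_6)$, if there are functions $f_1,\ldots,f_6$ on $M$ with $R=\sum_{i=1}^6 f_iR_i$, where $R_1(X,Y)Z=g(Y,Z)X-g(X,Z)Y$; $R_2(X,Y)Z=g(X,\phi Z)\phi Y-g(Y,\phi Z)\phi X+2g(X,\phi Y)\phi Z$; $R_3(X,Y)Z=\eta(X)\eta(Z)Y-\eta(Y)\eta(Z)X+g(X,Z)\eta(Y)\xi-g(Y,Z)\eta(X)\xi$; $R_4(X,Y)Z=g(Y,Z)hX-g(X,Z)hY+g(hY,Z)X-g(hX,Z)Y$; $R_5(X,Y)Z=g(hY,Z)hX-g(hX,Z)hY+g(\phi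 hX,Z)\phi hY-g(\phi hY,Z)\phi hX$; $R_6(X,Y)Z=\eta(X)\eta(Z)hY-\eta(Y)\eta(Z)hX+g(hX,Z)\eta(Y)\xi-g(hY,Z)\eta(X)\xi$. *)

(* Defs.v *)
From HB Require Import structures.
From mathcomp Require Import all_boot all_order all_algebra.
From mathcomp Require Import all_classical all_reals all_analysis.
From mathcomp Require Import ring.

Set Implicit Arguments.
Unset Strict Implicit.
Unset Printing Implicit Defensive.

Import Order.TTheory GRing.Theory Num.Theory.
Import numFieldNormedType.Exports.

Local Open Scope classical_set_scope.
Local Open Scope ring_scope.

(* Conventions (those of O'Neill's "Semi-Riemannian Geometry"):
   - a tangent vector at p is an R-linear Leibnizian map C^oo(M) -> R;
   - a vector field X is smooth when X f is smooth for every smooth f;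
   - a tensor field is a family of multilinear maps on the tangent spaces
     which yields a smooth result on smooth vector fields. *)

Section SmoothEuclidean.
Variables (R : realType) (n : nat).
Implicit Types (U : set 'rV[R]_n) (f g : 'rV[R]_n -> R).

(* Meaningful for open U only. *)
Fixpoint class_C (k : nat) U f : Prop :=
  (forall x, U x -> {for x, continuous f}) /\
  if k is k'.+1 then
    exists df : 'I_n -> 'rV[R]_n -> R, forall i,
      (forall x, U x -> is_derive x (delta_mx 0 i : 'rV[R]_n) f (df i x)) /\
      class_C k' U (df i)
  else True.

Definition smooth_on U f : Prop := forall k, class_C k U f.

Lemma class_C_cont k U f : class_C k U f -> forall x, U x -> {for x, continuous f}.
Proof. by case: k => [|k] []. Qed.

Lemma class_CS k U f : class_C k.+1 U f -> class_C k U f.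
Proof.
elim: k f => [|k IH] f [cf [df dfP]]; split=> //.
by exists df => i; have [H1 H2] := dfP i; split=> //; exact: IH.
Qed.

Lemma class_C_cst k U (a : R) : class_C k U (cst a).
Proof.
elim: k a => [|k IH] a; (split; first by move=> x _; exact: cst_continuous) => //.
by exists (fun _ => cst 0) => i; split=> // x _; exact: is_derive_cst.
Qed.

Lemma class_CD k U f g : class_C k U f -> class_C k U g -> class_C k U (f + g).
Proof.
elim: k f g => [|k IH] f g [cf Hf] [cg Hg];
  (split; first by move=> x Ux; apply: continuousD; [exact: cf|exact: cg]) => //.
have [df dfP] := Hf; have [dg dgP] := Hg.
exists (fun i => df i + dg i) => i.
have [f1 f2] := dfP i; have [g1 g2] := dgP i; split; last exact: IH.
by move=> x Ux; apply: is_deriveD; [exact: f1|exact: g1].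
Qed.

Lemma class_CM k U f g : class_C k U f -> class_C k U g -> class_C k U (f * g).
Proof.
elim: k f g => [|k IH] f g Hf Hg;
  (split; first by move=> x Ux; apply: continuousM; apply: class_C_cont Ux;
                   eassumption) => //.
have [_ [df dfP]] := Hf; have [_ [dg dgP]] := Hg.
exists (fun i => f * dg i + g * df i) => i.
have [f1 f2] := dfP i; have [g1 g2] := dgP i; split.
  move=> x Ux; apply: is_deriveM; [exact: f1|exact: g1].
by apply: class_CD; apply: IH => //; exact: class_CS.
Qed.

End SmoothEuclidean.

Record chart (R : realType) (n : nat) (M : topologicalType) := Chart {
  chart_dom : set M;
  chart_map : M -> 'rV[R]_n;
  chart_inv : 'rV[R]_n -> M;
  chart_cod := chart_map @` chart_dom;
  chart_dom_open : open chart_dom;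
  chart_cod_open : open chart_cod;
  chart_mapK : forall p, chart_dom p -> chart_inv (chart_map p) = p;
  chart_map_cont : forall p, chart_dom p -> {for p, continuous chart_map};
  chart_inv_cont : forall x, chart_cod x -> {for x, continuous chart_inv}
}.

Record manifold (R : realType) (n : nat) := Manifold {
  mf_carrier :> topologicalType;
  mf_hausdorff : hausdorff_space mf_carrier;
  mf_second_countable : @second_countable mf_carrier;
  mf_atlas : set (chart R n mf_carrier);
  mf_cover : forall p, exists2 c, mf_atlas c & chart_dom c p;
  mf_compat : forall c d, mf_atlas c -> mf_atlas d -> forall j : 'I_n,
    smooth_on (chart_map c @` (chart_dom c `&` chart_dom d))
      (fun x => chart_map d (chart_inv c x) 0 j)
}.

Section SmoothFunctions.
Variables (R : realType) (n : nat) (M : manifold R n).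

Definition smooth : set (M -> R) := [set f : M -> R | forall c, mf_atlas c ->
  smooth_on (chart_cod c) (f \o chart_inv c)].

Definition smooth_pred : {pred M -> R} := mem smooth.

Record smoothfun := SmoothFun {
  sf_val :> M -> R; sf_subproof : sf_val \in smooth_pred }.

HB.instance Definition _ := [isSub for sf_val].
HB.instance Definition _ := [Choice of smoothfun by <:].

Lemma smooth_cst a : smooth (cst a).
Proof. by move=> c _ k; exact: class_C_cst. Qed.

Lemma smoothD f g : smooth f -> smooth g -> smooth (f + g).
Proof. by move=> sf sg c ac k; apply: class_CD; [exact: sf|exact: sg]. Qed.

Lemma smoothM f g : smooth f -> smooth g -> smooth (f * g).
Proof. by move=> sf sg c ac k; apply: class_CM; [exact: sf|exact: sg]. Qed.

Lemma smoothN f : smooth f -> smooth (- f).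
Proof.
move=> sf; have -> : - f = cst (-1) * f.
  by apply/funext => x; rewrite fctE mulN1r.
by apply: smoothM => //; exact: smooth_cst.
Qed.

Lemma smooth_subring_closed : subring_closed smooth_pred.
Proof.
split=> [|f g|f g]; rewrite !inE.
- exact: smooth_cst.
- by move=> sf sg; apply: smoothD => //; exact: smoothN.
- exact: smoothM.
Qed.

HB.instance Definition _ :=
  GRing.isSubringClosed.Build (M -> R) smooth_pred smooth_subring_closed.
HB.instance Definition _ := GRing.SubChoice_isSubComPzRing.Build
  _ _ smoothfun smooth_subring_closed.

Definition sf_mk (f : M -> R) (sf : smooth f) : smoothfun :=
  SmoothFun (mem_set sf).

Definition sf_cst (a : R) : smoothfun := sf_mk (smooth_cst a).

Lemma sf_ext (f g : smoothfun) : (forall p, f p = g p) -> f = g.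
Proof. by move=> fg; apply/val_inj/funext. Qed.

Lemma sfP (f : smoothfun) : smooth f.
Proof. exact: set_mem (sf_subproof f). Qed.

End SmoothFunctions.

Section Tangent.
Variables (R : realType) (n : nat) (M : manifold R n) (p : M).

Definition leibnizian : set (smoothfun M -> R) := [set v : smoothfun M -> R |
  [/\ forall f g, v (f + g) = v f + v g,
      forall a f, v (sf_cst M a * f) = a * v f &
      forall f g, v (f * g) = v f * g p + f p * v g]].

Definition leibnizian_pred : {pred smoothfun M -> R} := mem leibnizian.

Record tangent := Tangent {
  tv_val :> smoothfun M -> R; tv_subproof : tv_val \in leibnizian_pred }.

HB.instance Definition _ := [isSub for tv_val].
HB.instance Definition _ := [Choice of tangent by <:].

Lemma leibnizian_submod_closed : submod_closed leibnizian_pred.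
Proof.
split=> [|a v w]; rewrite !inE.
  by split=> *; rewrite /= ?(mulr0, mul0r, addr0).
move=> [v1 v2 v3] [w1 w2 w3].
split=> [f g|b f|f g]; rewrite !fctE ?(v1, v2, v3, w1, w2, w3) /GRing.scale /=; ring.
Qed.

HB.instance Definition _ := GRing.isSubmodClosed.Build _ _
  leibnizian_pred leibnizian_submod_closed.
HB.instance Definition _ := [SubChoice_isSubLmodule of tangent by <:].

Definition tv_mk (v : smoothfun M -> R) (lv : leibnizian v) : tangent :=
  Tangent (mem_set lv).

Lemma tv_ext (v w : tangent) : (forall f, v f = w f) -> v = w.
Proof. by move=> vw; apply/val_inj/funext. Qed.

Lemma tvP (v : tangent) : leibnizian v.
Proof. exact: set_mem (tv_subproof v). Qed.

End Tangent.

Section VectorFields.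
Variables (R : realType) (n : nat) (M : manifold R n).

Record vectfield := VectField {
  vf_at :> forall p : M, tangent p;
  vf_smooth : forall f : smoothfun M, smooth (fun p => vf_at p f) }.

HB.instance Definition _ := gen_eqMixin vectfield.
HB.instance Definition _ := gen_choiceMixin vectfield.

Lemma vf_ext (X Y : vectfield) : (forall p, X p = Y p) -> X = Y.
Proof.
case: X Y => [X sX] [Y sY] /= XY.
have {}XY : X = Y by apply: functional_extensionality_dep.
by case: _ / XY sY => sY; congr VectField; exact: Prop_irrelevance.
Qed.

Definition vf_app (X : vectfield) (f : smoothfun M) : smoothfun M :=
  sf_mk (vf_smooth X f).

Lemma vf_zero_subproof (f : smoothfun M) :
  smooth (fun p : M => (0 : tangent p) f).
Proof. exact: smooth_cst. Qed.

Lemma vf_add_subproof (X Y : vectfield) (f : smoothfun M) :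
  smooth (fun p => (X p + Y p) f).
Proof. exact: (smoothD (vf_smooth X f) (vf_smooth Y f)). Qed.

Lemma vf_opp_subproof (X : vectfield) (f : smoothfun M) :
  smooth (fun p => (- X p) f).
Proof. exact: (smoothN (vf_smooth X f)). Qed.

Lemma vf_scale_subproof (a : smoothfun M) (X : vectfield) (f : smoothfun M) :
  smooth (fun p => (a p *: X p) f).
Proof. exact: (smoothM (sfP a) (vf_smooth X f)). Qed.

Definition vf_zero := VectField vf_zero_subproof.
Definition vf_add X Y := VectField (vf_add_subproof X Y).
Definition vf_opp X := VectField (vf_opp_subproof X).
Definition vf_scale a X := VectField (vf_scale_subproof a X).

Lemma vf_addA : associative vf_add.
Proof. by move=> X Y Z; apply: vf_ext => p /=; rewrite addrA. Qed.

Lemma vf_addC : commutative vf_add.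
Proof. by move=> X Y; apply: vf_ext => p /=; rewrite addrC. Qed.

Lemma vf_add0 : left_id vf_zero vf_add.
Proof. by move=> X; apply: vf_ext => p /=; rewrite add0r. Qed.

Lemma vf_addN : left_inverse vf_zero vf_opp vf_add.
Proof. by move=> X; apply: vf_ext => p /=; rewrite addNr. Qed.

HB.instance Definition _ :=
  GRing.isZmodule.Build vectfield vf_addA vf_addC vf_add0 vf_addN.

Lemma vf_scaleA a b X : vf_scale a (vf_scale b X) = vf_scale (a * b) X.
Proof. by apply: vf_ext => p /=; rewrite scalerA. Qed.

Lemma vf_scale1 : left_id 1 vf_scale.
Proof. by move=> X; apply: vf_ext => p /=; rewrite scale1r. Qed.

Lemma vf_scaleDr : right_distributive vf_scale +%R.
Proof. by move=> a X Y; apply: vf_ext => p /=; rewrite scalerDr. Qed.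

Lemma vf_scaleDl X : {morph vf_scale^~ X : a b / a + b}.
Proof. by move=> a b; apply: vf_ext => p /=; rewrite scalerDl. Qed.

HB.instance Definition _ := GRing.Zmodule_isLmodule.Build (smoothfun M)
  vectfield vf_scaleA vf_scale1 vf_scaleDr vf_scaleDl.

Definition bracket_at (X Y : vectfield) (p : M) (f : smoothfun M) : R :=
  X p (vf_app Y f) - Y p (vf_app X f).

Lemma vf_appD X f g : vf_app X (f + g) = vf_app X f + vf_app X g.
Proof. by apply: sf_ext => p /=; have [-> _ _] := tvP (X p). Qed.

Lemma vf_appZ X a f : vf_app X (sf_cst M a * f) = sf_cst M a * vf_app X f.
Proof. by apply: sf_ext => p /=; have [_ -> _] := tvP (X p). Qed.

Lemma vf_appM X f g : vf_app X (f * g) = vf_app X f * g + f * vf_app X g.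
Proof. by apply: sf_ext => p /=; have [_ _ ->] := tvP (X p). Qed.

Lemma bracket_leibnizian X Y p : leibnizian p (bracket_at X Y p).
Proof.
have [X1 X2 X3] := tvP (X p); have [Y1 Y2 Y3] := tvP (Y p).
split=> *; rewrite /bracket_at.
- by rewrite !vf_appD X1 Y1; ring.
- by rewrite !vf_appZ X2 Y2; ring.
- by rewrite !vf_appM X1 Y1 !X3 !Y3 /=; ring.
Qed.

Lemma bracket_smooth X Y (f : smoothfun M) :
  smooth (fun p => tv_mk (bracket_leibnizian X Y p) f).
Proof.
exact: (smoothD (vf_smooth X (vf_app Y f)) (smoothN (vf_smooth Y (vf_app X f)))).
Qed.

Definition bracket (X Y : vectfield) : vectfield :=
  VectField (bracket_smooth X Y).

End VectorFields.

Section Tensors.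
Variables (R : realType) (n : nat) (M : manifold R n).

Record rmetric := RMetric {
  rmetric_at : forall p : M, tangent p -> {scalar tangent p};
  rmetric_sym : forall p (u v : tangent p), rmetric_at u v = rmetric_at v u;
  rmetric_pos : forall p (u : tangent p), u != 0 -> 0 < rmetric_at u u;
  rmetric_smooth : forall X Y : vectfield M,
    smooth (fun p => rmetric_at (X p) (Y p)) }.

Definition rmetric_app (g : rmetric) (X Y : vectfield M) : smoothfun M :=
  sf_mk (rmetric_smooth g X Y).

Record tensor11 := Tensor11 {
  t11_at : forall p : M, {linear tangent p -> tangent p};
  t11_smooth : forall (X : vectfield M) (f : smoothfun M),
    smooth (fun p => t11_at p (X p) f) }.

Definition t11_app (T : tensor11) (X : vectfield M) : vectfield M :=
  VectField (t11_smooth T X).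

Record oneform := OneForm {
  of_at : forall p : M, {scalar tangent p};
  of_smooth : forall X : vectfield M, smooth (fun p => of_at p (X p)) }.

Definition of_app (w : oneform) (X : vectfield M) : smoothfun M :=
  sf_mk (of_smooth w X).

End Tensors.

Coercion rmetric_app : rmetric >-> Funclass.
Coercion t11_app : tensor11 >-> Funclass.
Coercion of_app : oneform >-> Funclass.

Section Connection.
Variables (R : realType) (n : nat) (M : manifold R n).
Implicit Types X Y Z : vectfield M.

Record levi_civita (g : rmetric M)
    (nabla : vectfield M -> vectfield M -> vectfield M) : Prop := {
  lc_linearl : forall f X Y Z,
    nabla (f *: X + Y) Z = f *: nabla X Z + nabla Y Z;
  lc_addr : forall X Y Z, nabla X (Y + Z) = nabla X Y + nabla X Z;
  lc_leibniz : forall f X Y,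
    nabla X (f *: Y) = vf_app X f *: Y + f *: nabla X Y;
  lc_torsion_free : forall X Y, nabla X Y - nabla Y X = bracket X Y;
  lc_metric : forall X Y Z,
    vf_app X (g Y Z) = g (nabla X Y) Z + g Y (nabla X Z) }.

Definition curvature (nabla : vectfield M -> vectfield M -> vectfield M)
    X Y Z : vectfield M :=
  nabla X (nabla Y Z) - nabla Y (nabla X Z) - nabla (bracket X Y) Z.

Definition lie11 (X : vectfield M) (T : tensor11 M) Y : vectfield M :=
  bracket X (T Y) - T (bracket X Y).

(* The normalization 2 d eta (X, Y) = X eta(Y) - Y eta(X) - eta([X, Y]). *)
Definition dform (w : oneform M) X Y : smoothfun M :=
  sf_cst M 2^-1 * (vf_app X (w Y) - vf_app Y (w X) - w (bracket X Y)).

End Connection.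

Record almost_contact_metric (R : realType) (n : nat) (M : manifold R n) :=
  AlmostContactMetric {
    acm_g : rmetric M;
    acm_phi : tensor11 M;
    acm_xi : vectfield M;
    acm_eta : oneform M;
    acm_odd : odd n;
    acm_eta_xi : acm_eta acm_xi = 1;
    acm_phi_sq : forall X : vectfield M,
      acm_phi (acm_phi X) = - X + acm_eta X *: acm_xi;
    acm_compat : forall X Y : vectfield M,
      acm_g (acm_phi X) (acm_phi Y) = acm_g X Y - acm_eta X * acm_eta Y }.

Section SpaceForms.
Variables (R : realType) (n : nat) (M : manifold R n).
Variable A : almost_contact_metric M.
Implicit Types X Y Z W : vectfield M.

Local Notation g := (acm_g A).
Local Notation phi := (acm_phi A).
Local Notation xi := (acm_xi A).
Local Notation eta := (acm_eta A).

Definition contact_metric : Prop :=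
  forall X Y, dform eta X Y = g X (phi Y).

Definition tensor_h X : vectfield M := sf_cst M 2^-1 *: lie11 xi phi X.

Local Notation h := tensor_h.

Definition R1 X Y Z : vectfield M := g Y Z *: X - g X Z *: Y.

Definition R2 X Y Z : vectfield M :=
  g X (phi Z) *: phi Y - g Y (phi Z) *: phi X + (g X (phi Y) *+ 2) *: phi Z.

Definition R3 X Y Z : vectfield M :=
  (eta X * eta Z) *: Y - (eta Y * eta Z) *: X
  + (g X Z * eta Y) *: xi - (g Y Z * eta X) *: xi.

Definition R4 X Y Z : vectfield M :=
  g Y Z *: h X - g X Z *: h Y + g (h Y) Z *: X - g (h X) Z *: Y.

Definition R5 X Y Z : vectfield M :=
  g (h Y) Z *: h X - g (h X) Z *: h Y
  + g (phi (h X)) Z *: phi (h Y) - g (phi (h Y)) Z *: phi (h X).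

Definition R6 X Y Z : vectfield M :=
  (eta X * eta Z) *: h Y - (eta Y * eta Z) *: h X
  + (g (h X) Z * eta Y) *: xi - (g (h Y) Z * eta X) *: xi.

(* S(X, Y, Z, W) = g(S(X, Y)Z, W) *)
Definition lower (S : vectfield M -> vectfield M -> vectfield M -> vectfield M)
    X Y Z W : smoothfun M := g (S X Y Z) W.

Definition generalized_space_form
    (nabla : vectfield M -> vectfield M -> vectfield M)
    (f1 f2 f3 f4 f5 f6 : smoothfun M) : Prop :=
  forall X Y Z, curvature nabla X Y Z =
    f1 *: R1 X Y Z + f2 *: R2 X Y Z + f3 *: R3 X Y Z
    + f4 *: R4 X Y Z + f5 *: R5 X Y Z + f6 *: R6 X Y Z.

Definition orth_xi X : Prop := g X xi = 0.

End SpaceForms.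

(* Main.v *)
(* The tensors h and phi anticommute on the contact distribution: there
   phi^2 = -1, so h phi + phi h is, up to a factor 2, the Lie derivative along
   xi of eta tensor xi, and L_xi eta = 2 d eta (xi, .) = 2 g(xi, phi .) vanishes
   on a contact metric manifold.  As phi is isometric on the distribution,
   R4, which has one h in each term, changes sign under phi, and R5, which has
   two, does not. *)

Require Import Defs.
From mathcomp Require Import all_boot all_order all_algebra.
From mathcomp Require Import all_classical all_reals all_analysis.

Set Implicit Arguments.
Unset Strict Implicit.
Unset Printing Implicit Defensive.

Import Order.TTheory GRing.Theory Num.Theory.
Local Open Scope ring_scope.

(** * Cancellations in an abelian group *)

Section Cancellation.
Variables (V : zmodType).
Implicit Types s a b c : V.

(** Fits the expansion of the curvature: [s] collects the terms of [R1], [R2], [R3], while [a], [b],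
    [c] are those of [R4], [R5], [R6]. *)
Lemma addr_cancel2 s a b c : s + a + b + c - a - b = s + c.
Proof. by rewrite (ACl (1*2*5*3*6*4))/= !addrK. Qed.

Lemma addr_double_cancel s a b c : s + a + b + c - (a + a) = s - a + b + c.
Proof. by rewrite opprD addrA (ACl (1*2*5*6*3*4))/= addrK. Qed.

End Cancellation.

(** * Linearity of tensors and derivations over smooth functions *)

Section TensorCalculus.
Variables (R : realType) (n : nat) (M : manifold R n).
Implicit Types (X Y Z : vectfield M) (f : smoothfun M).

Lemma rmetricC (g : rmetric M) X Y : g X Y = g Y X.
Proof. by apply: sf_ext => p; exact: rmetric_sym. Qed.

Lemma rmetricDr (g : rmetric M) X Y Z : g X (Y + Z) = g X Y + g X Z.
Proof. by apply: sf_ext => p /=; rewrite linearD. Qed.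

Lemma rmetricZr (g : rmetric M) f X Y : g X (f *: Y) = f * g X Y.
Proof. by apply: sf_ext => p /=; rewrite linearZ. Qed.

Lemma rmetricNr (g : rmetric M) X Y : g X (- Y) = - g X Y.
Proof. by apply: sf_ext => p /=; rewrite linearN. Qed.

Lemma rmetricDl (g : rmetric M) X Y Z : g (X + Y) Z = g X Z + g Y Z.
Proof. by rewrite rmetricC rmetricDr !(rmetricC g Z). Qed.

Lemma rmetricZl (g : rmetric M) f X Y : g (f *: X) Y = f * g X Y.
Proof. by rewrite rmetricC rmetricZr rmetricC. Qed.

Lemma rmetricNl (g : rmetric M) X Y : g (- X) Y = - g X Y.
Proof. by rewrite rmetricC rmetricNr rmetricC. Qed.

Definition rmetricE := (rmetricDl, rmetricNl, rmetricZl).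

Lemma t11D (T : tensor11 M) X Y : T (X + Y) = T X + T Y.
Proof. by apply: vf_ext => p /=; rewrite linearD. Qed.

Lemma t11N (T : tensor11 M) X : T (- X) = - T X.
Proof. by apply: vf_ext => p /=; rewrite linearN. Qed.

Lemma t11Z (T : tensor11 M) f X : T (f *: X) = f *: T X.
Proof. by apply: vf_ext => p /=; rewrite linearZ. Qed.

Lemma oneform0 (w : oneform M) : w 0 = 0.
Proof. by apply: sf_ext => p /=; rewrite linear0. Qed.

Lemma oneformZ (w : oneform M) f X : w (f *: X) = f * w X.
Proof. by apply: sf_ext => p /=; rewrite linearZ. Qed.

(** The Leibniz rule on [1 * 1] gives [X 1 = X 1 + X 1]. *)
Lemma vf_app1 X : vf_app X 1 = 0.
Proof.
have := vf_appM X 1 1; rewrite !mulr1 mul1r => /eqP.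
by rewrite -subr_eq0 opprD addNKr oppr_eq0 => /eqP.
Qed.

Lemma vf_app0 X : vf_app X 0 = 0.
Proof. by have := vf_appM X 0 0; rewrite !mulr0 mul0r addr0. Qed.

Lemma bracketNr X Y : bracket X (- Y) = - bracket X Y.
Proof.
apply: vf_ext => p; apply: tv_ext => f /=; rewrite /bracket_at /=.
have [XD XZ _] := tvP (X p).
(* Tangent vectors are homogeneous over constant functions, so the sign is written as the constant
   -1 before [XZ] pulls it out. *)
have -> : vf_app (- Y) f = sf_cst M (-1) * vf_app Y f.
  by apply: sf_ext => q /=; rewrite mulN1r.
by rewrite XZ /bracket_at fctE /= mulN1r opprB opprK addrC.
Qed.

Lemma half_mul_eq0 f : sf_cst M 2^-1 * f = 0 -> f = 0.
Proof.
move=> f0; apply: sf_ext => p.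
have /= /eqP := congr1 (fun u : smoothfun M => u p) f0.
by rewrite mulf_eq0 invr_eq0 pnatr_eq0 => /eqP.
Qed.

(** Smooth functions may have zero divisors, but their values lie in a field, so the ring has no
    nilpotents. *)
Lemma sf_sqr_eq0 f : f * f = 0 -> f = 0.
Proof.
move=> f0; apply: sf_ext => p.
have /= /eqP := congr1 (fun u : smoothfun M => u p) f0.
by rewrite mulf_eq0 orbb => /eqP.
Qed.

End TensorCalculus.

(** * Almost contact identities for [phi], [xi] and [eta] *)

Section AlmostContact.
Variables (R : realType) (n : nat) (M : manifold R n).
Variable A : almost_contact_metric M.
Implicit Types X Y Z W : vectfield M.

Local Notation g := (acm_g A).
Local Notation phi := (acm_phi A).
Local Notation xi := (acm_xi A).
Local Notation eta := (acm_eta A).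
Local Notation h := (tensor_h A).

(** The formula for [phi^2] at [phi xi] makes [phi xi] a multiple [a *: xi]; then [phi^2 xi = 0]
    forces [a * a = 0]. *)
Lemma phi_xi : phi xi = 0.
Proof.
have phi2 : phi (phi xi) = 0 by rewrite acm_phi_sq acm_eta_xi scale1r addNr.
have phi_xiE : phi xi = eta (phi xi) *: xi.
  (* Writing the zero field as [0 *: 0] lets [t11Z] show that [phi] sends it to zero. *)
  have := acm_phi_sq A (phi xi); rewrite phi2 -(scale0r 0) t11Z scale0r.
  by move/esym/eqP; rewrite addrC subr_eq0 => /eqP.
suff eta0 : eta (phi xi) = 0 by rewrite phi_xiE eta0 scale0r.
apply: sf_sqr_eq0; have := congr1 eta phi2.
by rewrite {1}phi_xiE t11Z oneformZ oneform0.
Qed.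

(** Compatibility at [(X, xi)], where the left side vanishes by [phi_xi]. Hence [orth_xi] amounts to
    the vanishing of [eta]. *)
Lemma eta_metric X : g X xi = eta X.
Proof.
have := acm_compat A X xi.
rewrite phi_xi acm_eta_xi mulr1 -(scale0r 0) rmetricZr mul0r.
by move/esym/eqP; rewrite subr_eq0 => /eqP.
Qed.

(** Bracketing [phi^3 X] in two ways leaves [eta (phi X) *: xi = 0], to which [eta] is applied. *)
Lemma eta_phi X : eta (phi X) = 0.
Proof.
have := acm_phi_sq A (phi X).
rewrite (acm_phi_sq A X) t11D t11N t11Z phi_xi scaler0 => /addrI/(congr1 eta).
by rewrite oneform0 oneformZ acm_eta_xi mulr1.
Qed.

Lemma phi_phi_orth X : orth_xi A X -> phi (phi X) = - X.
Proof.
by rewrite /orth_xi eta_metric acm_phi_sq => ->; rewrite scale0r addr0.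
Qed.

Lemma metric_phi X Y : eta Y = 0 -> g (phi X) (phi Y) = g X Y.
Proof. by move=> Y0; rewrite acm_compat Y0 mulr0 subr0. Qed.

(** * The tensors [R1] to [R6] on fields orthogonal to [xi] *)

Lemma lower_R1_phi X Y Z W : orth_xi A Z -> orth_xi A W ->
  lower A (R1 A) (phi X) (phi Y) (phi Z) (phi W) = lower A (R1 A) X Y Z W.
Proof.
rewrite /orth_xi !eta_metric => Z0 W0.
by rewrite /lower /R1 !rmetricE !metric_phi.
Qed.

(** The second argument of every metric factor is [W] or an image of [phi], and [eta] kills both. *)
Lemma lower_R2_phi X Y Z W : orth_xi A W ->
  lower A (R2 A) (phi X) (phi Y) (phi Z) (phi W) = lower A (R2 A) X Y Z W.
Proof.
rewrite /orth_xi eta_metric => W0.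
by rewrite /lower /R2 !rmetricE !metric_phi // eta_phi.
Qed.

(** Two terms carry [eta Z], the other two [g xi W]. As images of [phi] are orthogonal to [xi],
    invariance of [R3] reduces to [0 = 0]; [R6] behaves alike. *)
Lemma lower_R3_orth X Y Z W : orth_xi A Z -> orth_xi A W ->
  lower A (R3 A) X Y Z W = 0.
Proof.
rewrite /orth_xi => Z0 W0; rewrite /lower /R3 !rmetricE (rmetricC g xi) W0.
by rewrite -!eta_metric Z0 !mulr0 !mul0r !(addr0, subr0).
Qed.

Lemma lower_R4E X Y Z W : lower A (R4 A) X Y Z W =
  g Y Z * g (h X) W - g X Z * g (h Y) W + g (h Y) Z * g X W - g (h X) Z * g Y W.
Proof.
(* [h] is itself a scaling, which [rmetricZl] would unfold. *)
by rewrite /lower /R4; move: (h X) (h Y) => hX hY; rewrite !rmetricE.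
Qed.

Lemma lower_R5E X Y Z W : lower A (R5 A) X Y Z W =
  g (h Y) Z * g (h X) W - g (h X) Z * g (h Y) W
  + g (phi (h X)) Z * g (phi (h Y)) W - g (phi (h Y)) Z * g (phi (h X)) W.
Proof.
by rewrite /lower /R5; move: (h X) (h Y) => hX hY; rewrite !rmetricE.
Qed.

Lemma lower_R6_orth X Y Z W : orth_xi A Z -> orth_xi A W ->
  lower A (R6 A) X Y Z W = 0.
Proof.
rewrite /orth_xi => Z0 W0; rewrite /lower /R6 !rmetricE (rmetricC g xi) W0.
by rewrite -!eta_metric Z0 !mulr0 !mul0r !(addr0, subr0).
Qed.

Lemma orth_xi_phi X : orth_xi A (phi X).
Proof. by rewrite /orth_xi eta_metric eta_phi. Qed.

Lemma lower_space_form nabla f1 f2 f3 f4 f5 f6 X Y Z W :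
  generalized_space_form A nabla f1 f2 f3 f4 f5 f6 ->
  lower A (curvature nabla) X Y Z W =
    f1 * lower A (R1 A) X Y Z W + f2 * lower A (R2 A) X Y Z W
    + f3 * lower A (R3 A) X Y Z W + f4 * lower A (R4 A) X Y Z W
    + f5 * lower A (R5 A) X Y Z W + f6 * lower A (R6 A) X Y Z W.
Proof. by move=> MP; rewrite /lower MP !(rmetricDl, rmetricZl). Qed.

(** * The contact case: [h] against [phi] *)

Lemma eta_bracket_xi X (contactA : contact_metric A) :
  orth_xi A X -> eta (bracket xi X) = 0.
Proof.
rewrite /orth_xi eta_metric => X0; have := contactA xi X.
rewrite rmetricC eta_metric eta_phi => /half_mul_eq0.
(* Both [eta X = 0] and [eta xi = 1] are constant, so only the bracket term of [dform] at [(xi, X)]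
   survives. *)
rewrite X0 acm_eta_xi vf_app0 vf_app1 subr0 add0r => /eqP.
by rewrite oppr_eq0 => /eqP.
Qed.

(** Twice [h (phi X) + phi (h X)] is [[xi, phi^2 X] - phi^2 [xi, X]], and [phi^2] acts as -1 both on
    [X] and, by [eta_bracket_xi], on [[xi, X]]. *)
Lemma h_phi X (contactA : contact_metric A) :
  orth_xi A X -> h (phi X) = - phi (h X).
Proof.
move=> X0; apply/eqP; rewrite -subr_eq0 opprK /tensor_h /lie11 t11Z -scalerDr.
rewrite t11D t11N phi_phi_orth // acm_phi_sq eta_bracket_xi // scale0r addr0.
by rewrite bracketNr opprK addrA subrK addNr scaler0.
Qed.

Lemma metric_h_phi X Y (contactA : contact_metric A) :
  orth_xi A X -> orth_xi A Y ->
  g (h (phi X)) (phi Y) = - g (h X) Y.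
Proof.
by move=> X0 Y0; rewrite h_phi // rmetricNl metric_phi // -eta_metric.
Qed.

Lemma metric_phi_h_phi X Y (contactA : contact_metric A) :
  orth_xi A X -> orth_xi A Y ->
  g (phi (h (phi X))) (phi Y) = - g (phi (h X)) Y.
Proof.
by move=> X0 Y0; rewrite h_phi // t11N rmetricNl metric_phi // -eta_metric.
Qed.

Lemma lower_R4_phi X Y Z W (contactA : contact_metric A) :
  orth_xi A X -> orth_xi A Y -> orth_xi A Z -> orth_xi A W ->
  lower A (R4 A) (phi X) (phi Y) (phi Z) (phi W) = - lower A (R4 A) X Y Z W.
Proof.
move=> X0 Y0 Z0 W0; have metricP U V : orth_xi A V ->
    g (phi U) (phi V) = g U V by move=> V0; rewrite metric_phi // -eta_metric.
rewrite !lower_R4E (metricP Y Z) // (metricP X Z) // (metricP X W) //.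
rewrite (metricP Y W) // (metric_h_phi contactA X0 W0).
rewrite (metric_h_phi contactA Y0 W0) (metric_h_phi contactA Y0 Z0).
by rewrite (metric_h_phi contactA X0 Z0) !mulrN !mulNr -!opprD.
Qed.

Lemma lower_R5_phi X Y Z W (contactA : contact_metric A) :
  orth_xi A X -> orth_xi A Y -> orth_xi A Z -> orth_xi A W ->
  lower A (R5 A) (phi X) (phi Y) (phi Z) (phi W) = lower A (R5 A) X Y Z W.
Proof.
move=> X0 Y0 Z0 W0; have hE := metric_h_phi contactA.
have phihE := metric_phi_h_phi contactA.
rewrite !lower_R5E (hE X Z) // (hE X W) // (hE Y Z) // (hE Y W) //.
rewrite (phihE X Z) // (phihE X W) // (phihE Y Z) // (phihE Y W) //.
by rewrite !mulrNN.
Qed.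

End AlmostContact.

Theorem proposition3p11 (R : realType) (n : nat) (M : manifold R n)
    (A : almost_contact_metric M)
    (nabla : vectfield M -> vectfield M -> vectfield M)
    (f1 f2 f3 f4 f5 f6 : smoothfun M)
    (nablaP : levi_civita (acm_g A) nabla)
    (MP : generalized_space_form A nabla f1 f2 f3 f4 f5 f6) :
  let phi := acm_phi A in
  let Rm := lower A (curvature nabla) in
  let R1' := lower A (R1 A) in
  let R2' := lower A (R2 A) in
  let R3' := lower A (R3 A) in
  let R4' := lower A (R4 A) in
  let R5' := lower A (R5 A) in
  let R6' := lower A (R6 A) in
  (forall X Y Z W : vectfield M,
     orth_xi A X -> orth_xi A Y -> orth_xi A Z -> orth_xi A W ->
     [/\ R1' (phi X) (phi Y) (phi Z) (phi W) = R1' X Y Z W,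
         R2' (phi X) (phi Y) (phi Z) (phi W) = R2' X Y Z W,
         R3' (phi X) (phi Y) (phi Z) (phi W) = R3' X Y Z W &
         R6' (phi X) (phi Y) (phi Z) (phi W) = R6' X Y Z W] /\
     Rm (phi X) (phi Y) (phi Z) (phi W)
       - f4 * R4' (phi X) (phi Y) (phi Z) (phi W)
       - f5 * R5' (phi X) (phi Y) (phi Z) (phi W)
     = Rm X Y Z W - f4 * R4' X Y Z W - f5 * R5' X Y Z W) /\
  (contact_metric A ->
   forall X Y Z W : vectfield M,
     orth_xi A X -> orth_xi A Y -> orth_xi A Z -> orth_xi A W ->
     [/\ R4' (phi X) (phi Y) (phi Z) (phi W) = - R4' X Y Z W,
         R5' (phi X) (phi Y) (phi Z) (phi W) = R5' X Y Z W &
         Rm (phi X) (phi Y) (phi Z) (phi W)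
         = Rm X Y Z W - 2 * f4 * R4' X Y Z W]).
Proof.
move=> phi Rm R1' R2' R3' R4' R5' R6'.
have RmE := lower_space_form _ _ _ _ MP.
have R1P X Y Z W : orth_xi A Z -> orth_xi A W ->
    R1' (phi X) (phi Y) (phi Z) (phi W) = R1' X Y Z W by exact: lower_R1_phi.
have R2P X Y Z W : orth_xi A W ->
    R2' (phi X) (phi Y) (phi Z) (phi W) = R2' X Y Z W by exact: lower_R2_phi.
have R3P X Y Z W : orth_xi A Z -> orth_xi A W ->
    R3' (phi X) (phi Y) (phi Z) (phi W) = R3' X Y Z W.
  by move=> Z0 W0; rewrite /R3' !lower_R3_orth //; exact: orth_xi_phi.
have R6P X Y Z W : orth_xi A Z -> orth_xi A W ->
    R6' (phi X) (phi Y) (phi Z) (phi W) = R6' X Y Z W.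
  by move=> Z0 W0; rewrite /R6' !lower_R6_orth //; exact: orth_xi_phi.
split=> [|contactA] X Y Z W X0 Y0 Z0 W0.
  split; first by rewrite R1P // R2P // R3P // R6P.
  rewrite /Rm !RmE -/R1' -/R2' -/R3' -/R4' -/R5' -/R6'.
  rewrite R1P // R2P // R3P // R6P //.
  by rewrite !addr_cancel2.
have R4P := lower_R4_phi contactA X0 Y0 Z0 W0.
have R5P := lower_R5_phi contactA X0 Y0 Z0 W0.
split=> //.
rewrite /Rm !RmE -/R1' -/R2' -/R3' -/R4' -/R5' -/R6'.
rewrite R1P // R2P // R3P // R6P //.
(* The sign change of [R4] turns [+a] into [-a], with [a = f4 * R4]; the factor 2 is split as
   [a + a] to compare. *)
rewrite /R4' /R5' R4P R5P mulrN -mulrA mulr_natl mulr2n.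
by rewrite addr_double_cancel.
Qed.
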